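(* Let $P=\{p_1,\dots,p_n\}$ be a finite set, let $r\ge 2$ be an integer, and let $\mathcal{P}=\{\leq_a : a\in[r-1]\}$ be a family of partial order relations on $P$. Then the squarefree monomial ideal $H_r(\mathcal{P})$ of $S={\sf k}[X_{a,i}: a\in[r],\, i\in[n]]$ has a linear resolution.
   Context: ${\sf k}$ is a field, $[m]=\{1,\dots,m\}$, and $S={\sf k}[X_{a,i}: a\in [r], i\in[n]]$ is the polynomial ring with all $X_{a,i}$ distinct variables of degree $1$. For $a\in[r-1]$ let $P_a=(P,\leq_a)$. A poset ideal of $P_a$ is a subset $I\subset P$ such that $p\in I$, $q\in P$ and $q\leq_a p$ imply $q\in I$ (the empty set is allowed). $J(P_a)$ denotes the set of poset ideals of $P_a$. $K_r(\mathcal{P})$ is the set of tuples $\mathbf{I}=(I_1,\dots,I_{r-1})$ with $I_a\in J(P_a)$ for all $a\in[r-1]$ and $I_{r-1}\subset\cdots\subset I_1$ (inclusions not necessarily strict). For $\mathbf{I}\in K_r(\mathcal{P})$ put $u_{\mathbf{I}}=u_{I_1}u_{I_2}\cdots u_{I_{r-1}}$, where $u_{I_a}=\prod_{p_i\in I_a}X_{a,i}\prod_{p_i\in P\setminus I_a}X_{a+1,i}$ for $1\le a\le r-1$. Then $H_r(\mathcal{P})$ is the ideal of $S$ generated by all $u_{\mathbf{I}}$, $\mathbf{I}\in K_r(\mathcal{P})$. A homogeneous ideal $I\subset S$ generated in degree $d$ has a linear resolution if it has a graded free resolution $\cdots\to F_1\to F_0\to I\to 0$ over $S$ with $F_i\simeq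 S(-d-i)^{\beta_i}$ for all $i$, for some $\beta_i\in\mathbb{Z}_{\ge 0}$. *)

(* Defs.v *)
From HB Require Import structures.
From mathcomp Require Export all_boot all_algebra mpoly.

Set Implicit Arguments.
Unset Strict Implicit.
Unset Printing Implicit Defensive.

Import GRing.Theory.
Local Open Scope ring_scope.

Section LinearResolution.
Variables (N : nat) (k : fieldType).
Local Notation S := {mpoly k[N]}.

Definition ideal_gen (G : S -> Prop) (f : S) : Prop :=
  exists (m : nat) (c g : 'I_m -> S),
    (forall l, G (g l)) /\ f = \sum_(l < m) c l * g l.

Definition generated_in_degree (d : nat) (I : S -> Prop) : Prop :=
  exists G : S -> Prop,
    (forall g, G g -> g \is d.-homog) /\ (forall f, I f <-> ideal_gen G f).

(* The free module S(-e)^b has underlying module 'rV[S]_b; since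
   S(-e)_j = S_(j-e), its component of degree j consists of the vectors of
   forms of degree j - e, and vanishes for j < e. *)
Definition in_degree (e b j : nat) (v : 'rV[S]_b) : Prop :=
  forall l, if (e <= j)%N then v 0 l \is (j - e).-homog else v 0 l == 0.

(* A graded free resolution ... -> F_1 -> F_0 -> I -> 0 with
   F_i = S(-d-i)^(beta i): the maps phi i : F_(i+1) -> F_i and the
   augmentation eps : F_0 -> I are S-linear and preserve degrees. *)
Definition linear_free_resolution (d : nat) (I : S -> Prop) (beta : nat -> nat)
    (eps : {linear 'rV[S]_(beta 0%N) -> S^o})
    (phi : forall i, {linear 'rV[S]_(beta i.+1) -> 'rV[S]_(beta i)}) : Prop :=
  [/\ forall j v, in_degree d j v -> (eps v : S) \is j.-homog,
      forall i j v, in_degree (d + i.+1)%N j v -> in_degree (d + i)%N j (phi i v),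
      forall f, I f <-> exists v, eps v = f,
      forall v, eps v = 0 <-> exists w, phi 0%N w = v
    & forall i v, phi i v = 0 <-> exists w, phi i.+1 w = v].

Definition has_linear_resolution (I : S -> Prop) : Prop :=
  exists d : nat, generated_in_degree d I /\
  exists (beta : nat -> nat) (eps : {linear 'rV[S]_(beta 0%N) -> S^o})
    (phi : forall i, {linear 'rV[S]_(beta i.+1) -> 'rV[S]_(beta i)}),
    linear_free_resolution d I eps phi.

End LinearResolution.

Definition partial_order (P : Type) (le : rel P) : Prop :=
  [/\ reflexive le, antisymmetric le & transitive le].

Definition poset_ideals (P : finType) (le : rel P) : {set {set P}} :=
  [set I : {set P} | [forall x in I, forall y, le y x ==> (y \in I)]].

(* 'I_r stands for [r] and 'I_r.-1 for [r-1]; ord_same and ord_next send the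
   index a in [r-1] to the indices a and a+1 in [r]. *)
Definition ord_same (r : nat) (a : 'I_r.-1) : 'I_r := widen_ord (leq_pred r) a.

Lemma ord_next_subproof (r : nat) (a : 'I_r.-1) : (a.+1 < r)%N.
Proof. by rewrite -ltn_predRL. Qed.

Definition ord_next (r : nat) (a : 'I_r.-1) : 'I_r :=
  Ordinal (ord_next_subproof a).

Section GeneralizedHibiIdeal.
Variables (k : fieldType) (P : finType) (n r : nat) (p : 'I_n -> P).

(* The r * n variables X_(a,i) are numbered through mxvec_index. *)
Definition xvar (a : 'I_r) (i : 'I_n) : {mpoly k[r * n]} := 'X_(mxvec_index a i).

Definition multichains (le : 'I_r.-1 -> rel P) :
    {set {ffun 'I_r.-1 -> {set P}}} :=
  [set I : {ffun 'I_r.-1 -> {set P}} |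
     [forall a, I a \in poset_ideals (le a)] &&
     [forall a : 'I_r.-1, forall b : 'I_r.-1,
        (a <= b)%N ==> (I b \subset I a)]].

Definition u_poset_ideal (a : 'I_r.-1) (Ia : {set P}) : {mpoly k[r * n]} :=
  (\prod_(i < n | p i \in Ia) xvar (ord_same a) i) *
  (\prod_(i < n | p i \notin Ia) xvar (ord_next a) i).

Definition u_multichain (I : {ffun 'I_r.-1 -> {set P}}) : {mpoly k[r * n]} :=
  \prod_(a < r.-1) u_poset_ideal a (I a).

Definition hibi_ideal (le : 'I_r.-1 -> rel P) : {mpoly k[r * n]} -> Prop :=
  ideal_gen (fun g => exists2 I, I \in multichains le & g = u_multichain I).

End GeneralizedHibiIdeal.

Arguments hibi_ideal k {P n r} p le.

(* Main.v *)
From HB Require Import structures.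
Require Import Defs.

(** A multichain of poset ideals is the same as the function [s] sending [i] to
    the number of ideals containing [p i], and its generator is the product
    [umon s] of all the variables [X_(a, i)] with [a] different from [s i]. Let
    [L] be the set of the functions that arise. The ideal is resolved by a
    cubical complex: its cells are the pairs [(s, B)] with [s] in [L] and [B] a
    set of coordinates each of which can be lowered by one inside [L], and the
    vertices of the cell are the functions obtained from [s] by lowering some of
    the coordinates in [B] by one. Lowering one coordinate replaces one variable
    of the generator by another one, so all the coefficients of the homogenized
    boundary are signed variables and the complex is linear.

    Two properties of [L] are needed. Being closed under minimum
    ([level_maps_square]), it contains the vertices of the cells. And whenever
    [t j < s j] for some [j], there is some [i] with [t i < s i] such that [s]
    stays in [L] when its [i]-th coordinate is lowered ([level_maps_exchange]):
    take [i] maximal in a suitable difference of two ideals for the same order.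
    This amounts to saying that the ideal has linear quotients.

    Exactness ([cubical_exact]) goes by induction on the largest weight (sum of
    the values) occurring in a cycle. At a vertex [s] of largest weight, the
    boundary is the Koszul differential of the variables [X_(s i, i)], for [i] in
    the set of lowerable coordinates. The Koszul complex of distinct variables
    is exact ([koszul_exact]), so the boundary of some chain removes the
    contribution of [s]. In the lowest degree one has to know in addition that
    the coefficient at [s] of a syzygy lies in the ideal of these variables
    ([layer_top_kill]): setting them to zero kills all the other generators that
    occur and keeps [umon s]. *)

Set Implicit Arguments.
Unset Strict Implicit.
Unset Printing Implicit Defensive.

Import GRing.Theory.

(** * Signs, division by a variable and the Koszul complex *)

Section Koszul.
Local Open Scope ring_scope.

(** The incidence sign of the face of a cube obtained by contracting the
    direction [i], for cubes whose set of directions is [i |: B]. *)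
Definition ksgn (R : comNzRingType) (n : nat) (i : 'I_n) (B : {set 'I_n}) : R :=
  (-1) ^+ #|[set j in B | (j < i)%N]|.

Lemma ksgnU1 (R : comNzRingType) n (i j : 'I_n) (B : {set 'I_n}) : j \notin B ->
  ksgn R i (j |: B) = (-1) ^+ (j < i)%N * ksgn R i B.
Proof.
move=> jB; rewrite /ksgn -exprD; congr (_ ^+ _).
rewrite (cardsD1 j) !inE eqxx /=; congr (_ + _)%N.
apply: eq_card => l; rewrite !inE; case: eqP => [->|] //=.
by rewrite (negPf jB).
Qed.

Lemma ksgnK (R : comNzRingType) n (i : 'I_n) B : ksgn R i B * ksgn R i B = 1.
Proof. by rewrite -exprD addnn -mul2n exprM sqrrN !expr1n. Qed.

(** The two ways of contracting two directions of a cube carry opposite signs;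
    this is what makes a cubical boundary square to zero. *)
Lemma ksgn_swap (R : comNzRingType) n (i j : 'I_n) (B : {set 'I_n}) :
  i != j -> i \notin B -> j \notin B ->
  ksgn R j (i |: B) * ksgn R i B = - (ksgn R i (j |: B) * ksgn R j B).
Proof.
move=> ij iB jB; rewrite !ksgnU1 // -!mulrA [ksgn R j B * _]mulrC -mulNr.
congr (_ * _); have := ij; rewrite -val_eqE /=.
by case: ltngtP => //= _ _; rewrite ?expr0 ?expr1 ?opprK.
Qed.

(** The same sign change as in [ksgn_swap], in the form in which it relates one
    contraction and one extension; the contracting homotopy needs this one. *)
Lemma ksgn_swapM (R : comNzRingType) n (i j : 'I_n) (B : {set 'I_n}) :
  i != j -> i \notin B -> j \notin B ->
  ksgn R j (i |: B) * ksgn R i (j |: B) = - (ksgn R i B * ksgn R j B).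
Proof.
move=> ij iB jB; rewrite !ksgnU1 // mulrACA [ksgn R j B * _]mulrC -[RHS]mulN1r.
congr (_ * _); have := ij; rewrite -val_eqE /=.
by case: ltngtP => //= _ _; rewrite ?expr0 ?expr1 ?mulr1 ?mul1r.
Qed.

(** Common core of the identities [d o d = 0] below. Pairing [(i, j)] with
    [(j, i)], rather than showing that the sum equals its opposite, keeps the
    argument valid in characteristic 2. *)
Lemma sum_ksgn_sym (R : comNzRingType) n (B : {set 'I_n})
    (F : 'I_n -> 'I_n -> R) :
  (forall i j, i \notin B -> j \notin B -> i != j -> F i j = F j i) ->
  \sum_(i | i \notin B) \sum_(j | j \notin i |: B)
     ksgn R i B * ksgn R j (i |: B) * F i j = 0.
Proof.
move=> Fsym.
under eq_bigr => i iB.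
  rewrite (bigID (fun j : 'I_n => (i < j)%N)) /=; over.
rewrite big_split /= [X in _ + X](exchange_big_dep (fun j => j \notin B)) /=.
  2: by move=> i j _; rewrite !inE negb_or => /andP[/andP[]].
rewrite -big_split /= big1 // => i iB.
have E j : (j \notin B) && ((i \notin j |: B) && ~~ (j < i)%N)
    = (j \notin i |: B) && (i < j)%N.
  by rewrite !inE !negb_or iB -!val_eqE /=; case: ltngtP; rewrite ?andbF ?andbT.
rewrite [X in _ + X](eq_bigl _ _ E) -big_split /= big1 // => j.
rewrite !inE negb_or => /andP[/andP[ji jB] _].
rewrite (Fsym j i) // -mulrDl [ksgn R i B * _]mulrC [ksgn R j B * _]mulrC.
by rewrite (@ksgn_swap _ _ j i) // subrr mul0r.
Qed.

(** The Koszul differential of the sequence [x], with a chain given by its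
    coefficients on the exterior basis indexed by subsets. It is read backwards:
    the coefficient at [B] collects the contributions of all [i |: B]. *)
Definition kos (R : comNzRingType) n (x : 'I_n -> R) (g : {set 'I_n} -> R)
    (B : {set 'I_n}) : R :=
  \sum_(i | i \notin B) ksgn R i B * x i * g (i |: B).

Lemma kosK (R : comNzRingType) n (x : 'I_n -> R)
    (g : {set 'I_n} -> R) (B : {set 'I_n}) :
  kos x (kos x g) B = 0.
Proof.
rewrite -[RHS](@sum_ksgn_sym R n B (fun i j => x i * x j * g (i |: (j |: B)))).
  apply: eq_bigr => i iB; rewrite mulr_sumr; apply: eq_bigr => j jB.
  by rewrite !mulrA [j |: _]setUCA; congr (_ * _ * _); rewrite mulrAC.
by move=> i j _ _ _; rewrite mulrC [x i * _]mulrC mulrC setUCA.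
Qed.

Lemma kosD (R : comNzRingType) n (x : 'I_n -> R)
    (g h : {set 'I_n} -> R) (B : {set 'I_n}) :
  kos x (fun C => g C + h C) B = kos x g B + kos x h B.
Proof. by rewrite /kos -big_split; apply: eq_bigr => i _ /=; rewrite mulrDr. Qed.

Lemma kosN (R : comNzRingType) n (x : 'I_n -> R)
    (g : {set 'I_n} -> R) (B : {set 'I_n}) :
  kos x (fun C => - g C) B = - kos x g B.
Proof. by rewrite /kos -sumrN; apply: eq_bigr => i _ /=; rewrite mulrN. Qed.

Section Variables.
Variables (N : nat) (k : fieldType).
Local Notation S := {mpoly k[N]}.

Definition kill (E : {set 'I_N}) (p : S) : S :=
  p \mPo [tuple if i \in E then 0 else 'X_i | i < N].

HB.instance Definition _ E := GRing.RMorphism.copy (kill E)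
  (comp_mpoly [tuple if i \in E then 0 else 'X_i | i < N]).

Lemma killX E i : kill E 'X_i = if i \in E then 0 else 'X_i.
Proof. by rewrite /kill comp_mpolyXU -tnth_nth tnth_mktuple. Qed.

Lemma killC E c : kill E c%:MP = c%:MP.
Proof. exact: comp_mpolyC. Qed.

(** Setting variables to zero is a ring morphism, so its properties need only be
    tested on constants and variables; this avoids computing with monomials. *)
Lemma mpoly_ring_ind (Q : S -> Prop) :
  (forall c, Q c%:MP) -> (forall i, Q 'X_i) ->
  (forall p q, Q p -> Q q -> Q (p + q)) ->
  (forall p q, Q p -> Q q -> Q (p * q)) -> forall p, Q p.
Proof.
move=> QC QX QD QM; elim/mpolyind => [|c m p _ _ Qp]; first exact: (QC 0).
apply: QD => //; rewrite -mul_mpolyC; apply: (QM) => //; rewrite mpolyXE_id.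
apply: (big_ind Q) => [||i _]; [exact: (QC 1) | exact: (QM) |].
by elim: (m i) => [|e Qe]; [exact: (QC 1) | rewrite exprS; apply: QM].
Qed.

Lemma kill_kill E F p : kill E (kill F p) = kill (E :|: F) p.
Proof.
elim/mpoly_ring_ind: p => [c|i|p q Ep Eq|p q Ep Eq].
- by rewrite !killC.
- by rewrite !killX inE orbC; case: (i \in F); rewrite ?rmorph0 ?killX.
- by rewrite !rmorphD /= Ep Eq.
by rewrite !rmorphM /= Ep Eq.
Qed.

Lemma kill0 p : kill set0 p = p.
Proof.
elim/mpoly_ring_ind: p => [c|i|p q Ep Eq|p q Ep Eq].
- exact: killC.
- by rewrite killX inE.
- by rewrite rmorphD /= Ep Eq.
by rewrite rmorphM /= Ep Eq.
Qed.

(** The remainder of [p] modulo ['X_i] is obtained by setting ['X_i] to zero. *)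
Lemma kill1_dvd i p : exists q, 'X_i * q == p - kill [set i] p.
Proof.
elim/mpoly_ring_ind: p => [c|j|p q [a /eqP Ea] [b /eqP Eb]|p q [a /eqP Ea] [b /eqP Eb]].
- by exists 0; rewrite killC subrr mulr0.
- rewrite killX inE; case: eqP => [->|_]; first by exists 1; rewrite mulr1 subr0.
  by exists 0; rewrite mulr0 subrr.
- by exists (a + b); rewrite rmorphD /= mulrDr Ea Eb addrACA opprD.
exists (a * q + kill [set i] p * b).
rewrite rmorphM /= mulrDr mulrA Ea [X in _ + X]mulrCA Eb mulrBl mulrBr.
by rewrite addrA subrK.
Qed.

(** The quotient of [p] by ['X_i]. As ['X_i] is not a zero divisor, the equation
    [divXE] determines it, and its additivity and its compatibility with
    multiplication follow by cancellation. *)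
Definition divX i p : S := xchoose (kill1_dvd i p).

Lemma divXE i p : 'X_i * divX i p = p - kill [set i] p.
Proof. exact/eqP/(xchooseP (kill1_dvd i p)). Qed.

Lemma mpolyX_neq0 i : 'X_i != 0 :> S.
Proof. by rewrite -msize_poly_eq0 msizeX. Qed.

Lemma divX0 i : divX i 0 = 0.
Proof. by apply: (mulfI (mpolyX_neq0 i)); rewrite divXE rmorph0 subrr mulr0. Qed.

Lemma divXD i p q : divX i (p + q) = divX i p + divX i q.
Proof.
by apply: (mulfI (mpolyX_neq0 i)); rewrite mulrDr !divXE rmorphD /= addrACA opprD.
Qed.

Lemma divX_fixed i c p : kill [set i] c = c -> divX i (c * p) = c * divX i p.
Proof.
move=> Ec; apply: (mulfI (mpolyX_neq0 i)).
by rewrite mulrCA !divXE rmorphM /= Ec mulrBr.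
Qed.

Lemma divXX i p : divX i ('X_i * p) = p.
Proof.
apply: (mulfI (mpolyX_neq0 i)).
by rewrite divXE rmorphM /= killX inE eqxx mul0r subr0.
Qed.

(** Division by a single variable is a contracting homotopy of the Koszul
    complex, up to the projection that sets this variable to zero and forgets
    the subsets containing [i]. On a cycle it therefore gives an explicit
    primitive, up to a chain in which [i] and its variable no longer occur. *)
Lemma kos_homotopy n (x : 'I_n -> 'I_N) (i : 'I_n) (g : {set 'I_n} -> S) B :
  injective x -> (forall C, kos (fun j => 'X_(x j)) g C = 0) ->
  kos (fun j => 'X_(x j)) (fun C => if i \in C then
     ksgn _ i (C :\ i) * divX (x i) (g (C :\ i)) else 0) B
  = g B - (if i \in B then 0 else kill [set x i] (g B)).
Proof.
move=> injx cyc; case: ifPn => iB; last first.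
  rewrite /kos (bigD1 i) //= setU11 setU1K // mulrA -[_ * 'X_(x i) * _]mulrA.
  rewrite ['X_(x i) * _]mulrC mulrA ksgnK mul1r.
  rewrite divXE.
  rewrite big1 ?addr0 // => j /andP[_ ji].
  by rewrite !inE eq_sym (negPf ji) (negPf iB) mulr0.
set B' := B :\ i; have iB' : i \notin B' by rewrite !inE eqxx.
have EB : B = i |: B' by rewrite setD1K.
have divXsum (P : pred 'I_n) (F : 'I_n -> S) :
   divX (x i) (\sum_(j | P j) F j) = \sum_(j | P j) divX (x i) (F j).
  by apply: (big_morph _ (@divXD _) (@divX0 _)).
have ksgnfix j C : kill [set x i] (ksgn S j C) = ksgn S j C.
  by rewrite /ksgn rmorphXn rmorphN1.
(* Dividing the cycle condition at [B'] by the variable of [i] expresses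
   [g B] through the remaining terms of that condition. *)
have := congr1 (divX (x i)) (cyc B'); rewrite divX0 divXsum.
rewrite (bigD1 i) //= -EB -mulrA divX_fixed // divXX => /eqP.
rewrite addr_eq0 => /eqP /(congr1 (fun p => ksgn _ i B' * p)).
rewrite mulrA ksgnK mul1r subr0 => ->; rewrite -sumrN mulr_sumr /kos.
apply: eq_big => [j|j jB]; first by rewrite EB !inE negb_or andbC.
have jB' : j \notin B' by apply: contra jB; rewrite EB !inE => ->; rewrite orbT.
have ij : i != j by apply: contraNneq jB => <-.
rewrite setU1r // EB setUCA setU1K; last by rewrite in_setU1 negb_or ij.
have Xfix : kill [set x i] 'X_(x j) = 'X_(x j).
  by rewrite killX inE (inj_eq injx) eq_sym (negPf ij).
rewrite -(mulrA (ksgn _ j B')) (divX_fixed _ (ksgnfix _ _ _)) (divX_fixed _ Xfix).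
rewrite mulrACA ['X_(x j) * _]mulrC mulrA.
by rewrite ksgn_swapM // mulrN !mulNr -!mulrA.
Qed.

(** The Koszul complex of distinct variables is exact in positive degree, and in
    degree 0 its image is the ideal of the variables. The homotopies of the
    elements of [A] are applied one after the other: each removes one direction,
    and what survives them all is the value at the empty set with every variable
    of [A] set to zero. *)
Lemma koszul_exact n (x : 'I_n -> 'I_N) (A : {set 'I_n}) q
    (g : {set 'I_n} -> S) :
  injective x -> (forall B : {set 'I_n}, g B != 0 -> B \subset A /\ #|B| = q) ->
  (forall B, kos (fun j => 'X_(x j)) g B = 0) ->
  (q = 0%N -> kill (x @: A) (g set0) = 0) ->
  exists h : {set 'I_n} -> S,
    (forall B, h B != 0 -> B \subset A /\ #|B| = q.+1) /\
    forall B, kos (fun j => 'X_(x j)) h B = g B.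
Proof.
move=> injx; have [m] := ubnP #|A|; elim: m A g => // m IH A g lemA gA cyc top.
have [A0|[i iA]] := set_0Vmem A.
  (* Only the empty set carries a value; in positive degree not even that one. *)
  have g0 B : g B = 0.
    apply/eqP/negPn/negP => gB; have [] := gA B gB.
    rewrite A0 subset0 => /eqP B0; rewrite B0 cards0 => q0; case/eqP: gB.
    rewrite B0 -[LHS]kill0 -[RHS](top (esym q0)) A0 imset0.
    by [].
  exists (fun _ => 0); split=> [B|B]; first by rewrite eqxx.
  by rewrite g0 /kos big1 // => i _; rewrite mulr0.
pose h0 (C : {set 'I_n}) :=
  if i \in C then ksgn _ i (C :\ i) * divX (x i) (g (C :\ i)) else 0.
pose g' (C : {set 'I_n}) := g C - kos (fun j => 'X_(x j)) h0 C.
have g'E C : g' C = if i \in C then 0 else kill [set x i] (g C).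
  by rewrite /g' kos_homotopy // subKr.
have [||||h [hA hE]] := IH (A :\ i) g'.
- by move: lemA; rewrite (cardsD1 i A) iA.
- move=> B; rewrite g'E; case: ifPn => [_|iB gB]; first by rewrite eqxx.
  have gB0 : g B != 0 by apply: contraNneq gB => ->; rewrite rmorph0.
  by have [BA <-] := gA B gB0; rewrite subsetD1 BA.
- by move=> B; rewrite kosD kosN kosK cyc subrr.
- by move=> q0; rewrite g'E inE kill_kill setUC -imsetU1 setD1K // top.
exists (fun C => h C + h0 C); split=> [B hB|B]; last by rewrite kosD hE subrK.
have [h0B|h0B] := eqVneq (h B) 0; last first.
  by have [BA ->] := hA B h0B; split=> //; apply: subset_trans BA (subD1set _ _).
move: hB; rewrite h0B add0r /h0; case: ifP => [iB gB|]; last by rewrite eqxx.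
have : g (B :\ i) != 0 by apply: contraNneq gB => ->; rewrite divX0 mulr0.
move=> /gA[BA <-]; rewrite (cardsD1 i B) iB; split=> //.
by rewrite -(setD1K iB) subUset sub1set iA.
Qed.

End Variables.
End Koszul.

(** * The cubical complex on level functions *)

Section Cubical.
Local Open Scope ring_scope.
Variables (k : fieldType) (n r : nat).
Local Notation S := {mpoly k[r * n]}.
Local Notation V := {ffun 'I_n -> 'I_r}.
Implicit Types (s t : V) (i j : 'I_n) (B : {set 'I_n}).

(** The successor is cyclic, so [up i] and [dn i] are inverse bijections and no
    partial operation is needed. The wrap from [r - 1] to [0] is harmless: in
    the cells considered below, [up i s] only counts if its [i]-th value is
    positive. *)
Definition up i s : V := [ffun j => if j == i then ordS (s j) else s j].
Definition dn i s : V := [ffun j => if j == i then ord_pred (s j) else s j].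

Lemma upK i : cancel (up i) (dn i).
Proof. by move=> s; apply/ffunP=> j; rewrite !ffunE; case: eqP; rewrite ?ordSK. Qed.

Lemma dnK i : cancel (dn i) (up i).
Proof. by move=> s; apply/ffunP=> j; rewrite !ffunE; case: eqP; rewrite ?ord_predK. Qed.

Lemma up_neq i j s : j != i -> up i s j = s j.
Proof. by rewrite ffunE => /negPf ->. Qed.

Lemma dn_neq i j s : j != i -> dn i s j = s j.
Proof. by rewrite ffunE => /negPf ->. Qed.

Lemma dn_diag i s : (0 < s i)%N -> dn i s i = (s i).-1 :> nat.
Proof.
rewrite ffunE eqxx /= => si0.
by rewrite -{1}(prednK si0) addSn /= modnDr modn_small // (leq_ltn_trans (leq_pred _)).
Qed.

Lemma up_diag i s : (0 < up i s i)%N -> up i s i = (s i).+1 :> nat.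
Proof. by move=> u0; have := dn_diag u0; rewrite upK => ->; rewrite prednK. Qed.

Lemma upC i j s : up i (up j s) = up j (up i s).
Proof. by apply/ffunP=> l; rewrite !ffunE; case: eqP; case: eqP. Qed.

Definition weight s := (\sum_i (s i : nat))%N.

Lemma weight_up i s : (0 < up i s i)%N -> weight (up i s) = (weight s).+1.
Proof.
move=> /up_diag E; rewrite /weight (bigD1 i) //= E addSn [in RHS](bigD1 i) //=.
by congr (_ + _).+1; apply: eq_bigr => j ji; rewrite up_neq.
Qed.

Definition xat s i : 'I_(r * n) := mxvec_index (s i) i.

Lemma mxvec_index_inj (a b : 'I_r) i j :
  mxvec_index a i = mxvec_index b j -> a = b /\ i = j.
Proof.
have [g gK _] := curry_mxvec_bij r n => E.
have := gK (a, i) isT; rewrite /= E (gK (b, j) isT) => -[<- <-].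
by [].
Qed.

Lemma xat_inj s : injective (xat s).
Proof. by move=> i j /mxvec_index_inj[]. Qed.

Definition umon s : S :=
  \prod_(a < r.-1) \prod_(i < n) 'X_(mxvec_index (lift (s i) a) i).

Lemma umon_neq0 s : umon s != 0.
Proof.
by apply/prodf_neq0 => a _; apply/prodf_neq0 => i _; apply: mpolyX_neq0.
Qed.

(** In each column [i] exactly one variable is missing, the one at level [s i].
    Hence lowering one value of [s] exchanges two variables. *)
Lemma umonE s : umon s = \prod_(i < n) \prod_(a < r | a != s i) 'X_(mxvec_index a i).
Proof.
rewrite /umon exchange_big; apply: eq_bigr => i _.
rewrite [in RHS](reindex_omap (lift (s i)) (unlift (s i))) /=.
  by apply: eq_bigl => a; rewrite eq_sym neq_lift liftK eqxx.
by move=> a asi; case: unliftP asi => [b ->|->] //; rewrite ?liftK ?eqxx.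
Qed.

(** Both sides contain all the variables of column [i], and agree elsewhere. *)
Lemma umon_move s t i : (forall j, j != i -> s j = t j) ->
  'X_(xat s i) * umon s = 'X_(xat t i) * umon t.
Proof.
move=> st; have E v : 'X_(xat v i) * umon v =
    (\prod_a 'X_(mxvec_index a i)) *
    \prod_(j < n | j != i) \prod_(a < r | a != v j) 'X_(mxvec_index a j) :> S.
  by rewrite umonE (bigD1 i) //= mulrA [in RHS](bigD1 (v i)).
by rewrite !E; congr (_ * _); apply: eq_bigr => j /st ->.
Qed.

Lemma kill_umon_eq0 (E : {set 'I_(r * n)}) s i a :
  a != s i -> mxvec_index a i \in E -> kill E (umon s) = 0.
Proof.
move=> asi aE; rewrite umonE (bigD1 i) //= (bigD1 a) //=.
by rewrite !rmorphM /= killX aE !mul0r.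
Qed.

Lemma kill_umon (A : {set 'I_n}) s : kill (xat s @: A) (umon s) = umon s.
Proof.
rewrite umonE rmorph_prod; apply: eq_bigr => i _.
rewrite rmorph_prod; apply: eq_bigr => a asi; rewrite /= killX.
case: imsetP => // -[j _ /mxvec_index_inj[Ea Ei]].
by case/eqP: asi; rewrite Ea Ei.
Qed.

Lemma umon_homog s : umon s \is (r.-1 * n).-homog.
Proof.
have prodH (I : finType) (F : I -> S) d : (forall a, F a \is d.-homog) ->
    \prod_a F a \is (#|I| * d).-homog.
  move=> FH; rewrite -big_enum cardE /=.
  elim: (enum I) => [|i e IHe]; first by rewrite big_nil dhomog1.
  by rewrite big_cons mulSn dhomogM.
have -> : (r.-1 * n = #|'I_r.-1| * (#|'I_n| * 1))%N by rewrite !card_ord muln1.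
by apply: (prodH) => a; apply: (prodH) => i; rewrite dhomogX /= mdeg1.
Qed.

(** The boundary of a chain on cubes. The cube with top vertex [s] and directions
    [B] is the box of the vertices obtained from [s] by lowering some of the
    coordinates in [B] by one. Its boundary consists, for [i] in [B], of the
    face keeping the top vertex, with coefficient ['X_(s i, i)], and of the face
    with top vertex [dn i s], with coefficient minus ['X_(s i - 1, i)]; these are
    the coefficients that homogenize the boundary with respect to the labels
    [umon]. Collected at the face [(s, B)], the cubes [(s, i |: B)] and
    [(up i s, i |: B)] both contribute with the variable ['X_(s i, i)]. *)
Definition bd (f : V -> {set 'I_n} -> S) s B : S :=
  \sum_(i | i \notin B) ksgn S i B * 'X_(xat s i) * (f s (i |: B) - f (up i s) (i |: B)).

Definition aug (f : V -> {set 'I_n} -> S) : S := \sum_s f s set0 * umon s.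

Lemma bd_bd f s B : bd (bd f) s B = 0.
Proof.
pose F i j := 'X_(xat s i) * 'X_(xat s j) *
  ((f s (i |: (j |: B)) + f (up i (up j s)) (i |: (j |: B)))
  - (f (up i s) (i |: (j |: B)) + f (up j s) (i |: (j |: B)))) : S.
rewrite -[RHS](@sum_ksgn_sym S n B F).
  apply: eq_bigr => i iB; rewrite /bd -sumrB mulr_sumr; apply: eq_bigr => j.
  rewrite in_setU1 negb_or => /andP[ji jB].
  rewrite /xat up_neq // -mulrBr /F -!mulrA; congr (_ * _).
  rewrite [LHS]mulrCA; congr (_ * (_ * (_ * _))).
  by rewrite [j |: _]setUCA (upC j i) opprB addrACA -opprD [X in _ - X]addrC.
move=> i j _ _ _; rewrite /F [i |: _]setUCA (upC i j) ['X_(xat s i) * _]mulrC.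
by rewrite [X in _ - X]addrC.
Qed.

Lemma bdB f g s B : bd (fun t C => f t C - g t C) s B = bd f s B - bd g s B.
Proof.
rewrite /bd -sumrB; apply: eq_bigr => i _; rewrite -mulrBr; congr (_ * _).
by rewrite !opprB addrACA [RHS]addrACA [- f _ _ + _]addrC.
Qed.

Lemma bd_linear a f g s B :
  bd (fun t C => a * f t C + g t C) s B = a * bd f s B + bd g s B.
Proof.
rewrite /bd mulr_sumr -big_split; apply: eq_bigr => i _ /=.
by rewrite opprD addrACA -mulrBr mulrDr mulrCA.
Qed.

Lemma aug_linear a f g : aug (fun t C => a * f t C + g t C) = a * aug f + aug g.
Proof.
by rewrite /aug mulr_sumr -big_split; apply: eq_bigr => s _; rewrite mulrDl mulrA.
Qed.

Lemma eq_bd f g s B : (forall t C, f t C = g t C) -> bd f s B = bd g s B.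
Proof. by move=> fg; apply: eq_bigr => i _; rewrite !fg. Qed.

Lemma augB f g : aug (fun t C => f t C - g t C) = aug f - aug g.
Proof. by rewrite /aug -sumrB; apply: eq_bigr => s _; rewrite mulrBl. Qed.

(** An edge from [dn i s] to [s] is sent to ['X_(s i, i) umon s] minus
    ['X_(s i - 1, i) umon (dn i s)], which vanishes by [umon_move]. *)
Lemma aug_bd f : aug (bd f) = 0.
Proof.
rewrite /aug; under eq_bigr => s _ do rewrite /bd mulr_suml.
rewrite exchange_big big1 //= => i _; rewrite setU0.
under eq_bigr => s _ do rewrite mulrBr mulrBl.
rewrite big_split /= sumrN.
rewrite [X in _ - X](reindex_inj (can_inj (dnK i))) /=.
rewrite -sumrB big1 // => s _; rewrite dnK.
rewrite -!mulrA ['X_(xat s i) * _]mulrCA ['X_(xat (dn i s) i) * _]mulrCA.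
by rewrite (@umon_move (dn i s) s i) ?subrr // => j /dn_neq.
Qed.

End Cubical.

(** * Exactness and the linear resolution *)

Section Resolution.
Local Open Scope ring_scope.
Variables (k : fieldType) (n r : nat).
Local Notation S := {mpoly k[r * n]}.
Local Notation V := {ffun 'I_n -> 'I_r}.
Implicit Types (s t : V) (i j : 'I_n) (B : {set 'I_n}).
Variable L : {set V}.

(** The directions in which one can go down by one step from [s] inside [L]. *)
Definition drops s : {set 'I_n} := [set i : 'I_n | (0 < s i)%N && (dn i s \in L)].

Lemma in_drops s i : (i \in drops s) = (0 < s i)%N && (dn i s \in L).
Proof. by rewrite inE. Qed.

(** The two properties of [L] that make the complex a resolution. The first says
    that the lower vertices of a cell lie in [L]. The second is the linear
    quotient property: if some value of [t] is smaller than the corresponding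
    value of [s], then [umon t] is divisible by a variable ['X_(s i, i)] with
    [i] a drop of [s]. *)
Hypothesis drop_square : forall s i j, i != j ->
  i \in drops s -> j \in drops s -> dn j (dn i s) \in L.
Hypothesis drop_exchange : forall s t j, s \in L -> t \in L -> (t j < s j)%N ->
  exists2 i, i \in drops s & (t i < s i)%N.

Definition cell q s B := [&& s \in L, B \subset drops s & #|B| == q].

Definition carried q (f : V -> {set 'I_n} -> S) :=
  forall s B, f s B != 0 -> cell q s B.

Lemma cell_face q s i B : i \notin B -> cell q.+1 s (i |: B) -> cell q s B.
Proof.
move=> iB /and3P[sL]; rewrite subUset cardsU1 iB => /andP[_ Bs] qB.
exact/and3P.
Qed.

(** The faces lying opposite to the top vertex are cells thanks to
    [drop_square], applied at the top vertex [up i s]. *)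
Lemma cell_face_dn q s i B : i \notin B -> cell q.+1 (up i s) (i |: B) -> cell q s B.
Proof.
move=> iB /and3P[sL]; rewrite subUset sub1set cardsU1 iB => /andP[iu Bu] qB.
have /andP[_ sL'] : (0 < up i s i)%N && (s \in L) by move: iu; rewrite inE upK.
apply/and3P; split=> //; apply/subsetP=> j jB.
have ji : j != i by apply: contraNneq iB => <-.
have ju := subsetP Bu j jB; rewrite inE; apply/andP; split.
  by move: ju; rewrite inE up_neq // => /andP[].
by rewrite -(upK i s); apply: drop_square; rewrite 1?eq_sym.
Qed.

Lemma carried_bd q f : carried q.+1 f -> carried q (bd f).
Proof.
move=> fq s B; apply: contraR => nc; apply/eqP/big1 => i iB.
have [-> ->] : f s (i |: B) = 0 /\ f (up i s) (i |: B) = 0.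
  split; apply/eqP; apply: contraNT nc => /fq; first exact: cell_face.
  exact: cell_face_dn.
by rewrite subrr mulr0.
Qed.

Lemma lt_weight_exists s t : s != t -> (weight t <= weight s)%N ->
  exists j, (t j < s j)%N.
Proof.
move=> st ts; apply/existsP; apply: contraR st => /existsPn le_st.
have /leqif_sum lest : forall i, true -> (s i <= t i ?= iff (s i == t i :> nat))%N.
  by move=> i _; split; rewrite // leqNgt le_st.
have [le_w eq_w] := lest.
apply/eqP/ffunP=> i; apply/val_inj/eqP.
have : (weight s == weight t) by rewrite eqn_leq le_w ts.
by rewrite eq_w => /forallP/(_ i).
Qed.

(** The syzygies of the generators have their leading coefficient in the ideal
    of the variables of the drops. Setting these variables to zero kills every
    [umon t] with [t] different from [s] and not heavier than [s], by
    [drop_exchange], and leaves [umon s] unchanged. *)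
Lemma layer_top_kill f s : s \in L -> carried 0%N f ->
  (forall t B, (weight s < weight t)%N -> f t B = 0) -> aug f = 0 ->
  kill (xat s @: drops s) (f s set0) = 0.
Proof.
move=> sL f0 flow augf; apply: (mulIf (umon_neq0 k s)).
have := congr1 (kill (xat s @: drops s)) augf; rewrite mul0r rmorph0 => <-.
rewrite rmorph_sum (bigD1 s) //= rmorphM /= kill_umon big1 ?addr0 // => t ts.
have [->|ft] := eqVneq (f t set0) 0; first by rewrite mul0r rmorph0.
have /and3P[tL _ _] := f0 _ _ ft.
have le_ts : (weight t <= weight s)%N.
  by rewrite leqNgt; apply: contraNN ft => /flow ->.
have [|j tj] := @lt_weight_exists s t _ le_ts; first by rewrite eq_sym.
have [i iD ti] := drop_exchange sL tL tj.
rewrite rmorphM /= [X in _ * X](@kill_umon_eq0 _ _ _ _ t i (s i)) ?mulr0 //.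
  by rewrite -val_eqE /= gtn_eqF.
exact: imset_f.
Qed.

(** On the vertices of maximal weight in its support, a cycle is a family of
    Koszul cycles: the cubes with top vertex [up i s] are heavier, so only the
    Koszul part of the boundary is left at [s]. *)
Lemma layer_koszul m q f s : carried q f ->
  (forall t B, (m < weight t)%N -> f t B = 0) ->
  (forall t B, bd f t B = 0) -> (q = 0%N -> aug f = 0) ->
  exists h : {set 'I_n} -> S,
    (forall B, h B != 0 -> weight s = m /\ cell q.+1 s B) /\
    (weight s = m -> forall B, kos (fun i => 'X_(xat s i)) h B = f s B).
Proof.
move=> fq flow cyc top.
have [/andP[/eqP sm sL]|ns] := boolP ((weight s == m) && (s \in L)); last first.
  exists (fun _ => 0); split=> [B|sm B]; first by rewrite eqxx.
  rewrite /kos big1 => [|i _]; last by rewrite mulr0.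
  apply/esym/eqP; apply: contraNT ns => /fq /and3P[-> _ _].
  by rewrite sm eqxx.
have [||||h [hA hE]] := @koszul_exact _ k n (xat s) (drops s) q (f s).
- exact: xat_inj.
- by move=> B /fq /and3P[_ ? /eqP].
- move=> B; rewrite -[RHS](cyc s B); apply: eq_bigr => i iB; congr (_ * _).
  suff -> : f (up i s) (i |: B) = 0 by rewrite subr0.
  have [//|fu] := eqVneq (f (up i s) (i |: B)) 0.
  have /and3P[_ /subsetP/(_ i (setU11 _ _)) iu _] := fq _ _ fu.
  by apply: flow; rewrite weight_up ?sm //; move: iu; rewrite inE => /andP[].
- move=> q0; apply: layer_top_kill => //; last exact: top q0.
    by rewrite -q0.
  by rewrite sm.
exists h; split=> // B /hA[BA BN]; split=> //.
by rewrite /cell sL BA BN eqxx.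
Qed.

(** Subtracting the boundary of Koszul primitives on the top layer of a cycle
    lowers the weight of its support. *)
Lemma cubical_exact q f : carried q f ->
  (forall s B, bd f s B = 0) -> (q = 0%N -> aug f = 0) ->
  exists g, carried q.+1 g /\ forall s B, bd g s B = f s B.
Proof.
pose bound := (\max_(s : V) weight s).+1.
have : forall s B, (bound <= weight s)%N -> f s B = 0.
  by move=> s B; rewrite ltnNge leq_bigmax.
elim: bound f => [|m IH] f flow fq cyc top.
  exists (fun _ _ => 0); split=> [s B|s B]; first by rewrite eqxx.
  by rewrite flow // /bd big1 // => i _; rewrite subr0 mulr0.
have [h hP] := fin_all_exists (fun s => layer_koszul s fq flow cyc top).
have hq : carried q.+1 h by move=> s B /(proj1 (hP s) B)[].
have h_up s i B : (m <= weight s)%N -> h (up i s) (i |: B) = 0.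
  move=> ms; apply/eqP; apply: contraTT ms => /(proj1 (hP _) _)[<-].
  case/and3P=> _ /subsetP/(_ i (setU11 _ _)); rewrite inE => /andP[iu _] _.
  by rewrite -ltnNge weight_up.
have [|||q0|g [gq gE]] := IH (fun s B => f s B - bd h s B).
- move=> s B ms; have -> : bd h s B = kos (fun i => 'X_(xat s i)) (h s) B.
    by apply: eq_bigr => i _; rewrite h_up ?subr0.
  have [sm|m_s] := eqVneq (weight s) m; first by rewrite (proj2 (hP s)) ?subrr.
  rewrite flow ?sub0r; last by rewrite ltn_neqAle eq_sym m_s.
  rewrite /kos big1 ?oppr0 // => i _.
  have [->|/(proj1 (hP s) _)[sm _]] := eqVneq (h s (i |: B)) 0; first exact: mulr0.
  by rewrite sm eqxx in m_s.
- move=> s B /=; have [-> /=|fs _] := eqVneq (f s B) 0; last exact: fq.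
  by rewrite sub0r oppr_eq0; apply: carried_bd.
- by move=> s B; rewrite bdB cyc bd_bd subrr.
- by rewrite augB aug_bd subr0 top.
exists (fun s B => 1 * g s B + h s B); split=> [s B|s B]; last first.
  by rewrite bd_linear gE mul1r subrK.
by have [->|/gq //] := eqVneq (g s B) 0; rewrite mulr0 add0r; apply: hq.
Qed.

Definition cells q : {set V * {set 'I_n}} := [set c | cell q c.1 c.2].
Definition betti q := #|cells q|.

(** Row vectors and chains on the cells of dimension [q] are two forms of the
    same data. The sum has at most one term; it makes the value zero outside the
    cells and avoids choosing an index for them. *)
Definition chain q (v : 'rV[S]_(betti q)) s B : S :=
  \sum_(l < betti q | enum_val l == (s, B)) v 0 l.

Definition coords q (f : V -> {set 'I_n} -> S) : 'rV[S]_(betti q) :=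
  \row_l f (enum_val l).1 (enum_val l).2.

Lemma carried_chain q (v : 'rV[S]_(betti q)) : carried q (chain v).
Proof.
move=> s B; apply: contraR => nc; apply/eqP/big1 => l /eqP El.
by case/negP: nc; have := enum_valP l; rewrite El inE.
Qed.

Lemma coordsK q f s B : carried q f -> chain (coords q f) s B = f s B.
Proof.
move=> fq; have [f0|/fq c] := eqVneq (f s B) 0.
  by rewrite f0 /chain big1 // => l /eqP El; rewrite mxE El.
have cB : (s, B) \in cells q by rewrite inE.
rewrite /chain (big_pred1 (enum_rank_in cB (s, B))) => [|l].
  by rewrite mxE enum_rankK_in.
by rewrite /= -(inj_eq enum_val_inj) enum_rankK_in.
Qed.

Lemma chainK q : cancel (@chain q) (coords q).
Proof.
move=> v; apply/rowP=> l; rewrite mxE /chain (big_pred1 l) // => l'.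
by rewrite /= -surjective_pairing (inj_eq enum_val_inj).
Qed.

Lemma eq_coords q f g : (forall s B, f s B = g s B) -> coords q f = coords q g.
Proof. by move=> fg; apply/rowP=> l; rewrite !mxE. Qed.

Lemma chain_linear q a (v w : 'rV[S]_(betti q)) s B :
  chain (a *: v + w) s B = a * chain v s B + chain w s B.
Proof.
by rewrite /chain mulr_sumr -big_split; apply: eq_bigr => l _; rewrite !mxE.
Qed.

Definition phi q (v : 'rV[S]_(betti q.+1)) : 'rV[S]_(betti q) := coords q (bd (chain v)).

Definition eps (v : 'rV[S]_(betti 0%N)) : S^o := aug (chain v).

Lemma phi_is_linear q : linear (@phi q).
Proof.
move=> a v w; apply/rowP=> l; rewrite !mxE -bd_linear; apply: eq_bd => t C.
exact: chain_linear.
Qed.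

HB.instance Definition _ q :=
  GRing.isLinear.Build S 'rV[S]_(betti q.+1) 'rV[S]_(betti q) _ (@phi q)
    (@phi_is_linear q).

Lemma eps_is_linear : linear eps.
Proof.
move=> a v w; rewrite /eps [RHS](esym (aug_linear _ _ _)).
by apply: eq_bigr => t _; rewrite chain_linear.
Qed.

HB.instance Definition _ :=
  GRing.isLinear.Build S 'rV[S]_(betti 0%N) S^o _ eps eps_is_linear.

Lemma in_degree0 e b (j : nat) v : @in_degree (r * n) k e b j v -> forall l,
  v 0 l \is (j - e).-homog.
Proof. by move=> H l; have := H l; case: ifP => // _ /eqP->; rewrite dhomog0. Qed.

Lemma in_degree_ord0 e b (j : nat) v : (j < e)%N -> @in_degree (r * n) k e b j v -> v = 0.
Proof.
move=> je H; apply/rowP=> l; have := H l; rewrite leqNgt je /= mxE.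
by move/eqP.
Qed.

Lemma chain_homog q (v : 'rV[S]_(betti q)) d s B :
  (forall l, v 0 l \is d.-homog) -> chain v s B \is d.-homog.
Proof. by move=> vd; apply: rpred_sum => l _. Qed.

Lemma eps_degree (j : nat) v : in_degree (r.-1 * n)%N j v -> (eps v : S) \is j.-homog.
Proof.
have [jd vd|dj vd] := ltnP j (r.-1 * n)%N.
  by rewrite (in_degree_ord0 jd vd) raddf0 dhomog0.
rewrite /eps -(subnK dj); apply: rpred_sum => s _; apply: dhomogM.
  exact/chain_homog/in_degree0.
exact: umon_homog.
Qed.

Lemma phi_degree q (j : nat) v : in_degree (r.-1 * n + q.+1)%N j v ->
  in_degree (r.-1 * n + q)%N j (phi v : 'rV_(betti q)).
Proof.
have [jd vd l|dj vd l] := ltnP j (r.-1 * n + q.+1)%N.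
  by rewrite (in_degree_ord0 jd vd) raddf0 mxE dhomog0 eqxx if_same.
rewrite addnS in dj vd *; rewrite (ltnW dj) mxE; apply: rpred_sum => i _.
have -> : (j - (r.-1 * n + q) = 0 + 1 + (j - (r.-1 * n + q).+1))%N.
  by rewrite add0n add1n subnSK.
apply: dhomogM; last by apply: rpredB; apply/chain_homog/in_degree0.
apply: dhomogM; last by rewrite dhomogX /= mdeg1.
by rewrite /ksgn -signr_odd; case: odd; rewrite ?dhomogN dhomog1.
Qed.

Lemma eps_image (G : S -> Prop) f :
  (forall g, G g <-> exists2 s, s \in L & g = umon k s) ->
  ideal_gen G f <-> exists v, eps v = f.
Proof.
move=> GL; split=> [[m [c [g [Gg ->]]]]|[v <-]].
  have /fin_all_exists[w wE] l : exists w, eps w = g l.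
    have /GL[s sL ->] := Gg l.
    (* The basis vector of the vertex [s]. *)
    pose f0 t B : S := if (t == s) && (B == set0) then 1 else 0.
    exists (coords 0%N f0); rewrite -[RHS]mul1r /eps /aug.
    have f0c : carried 0%N f0.
      move=> t B; rewrite /f0; case: ifP => [/andP[/eqP-> /eqP->] _|]; last by rewrite eqxx.
      by rewrite /cell sL sub0set cards0.
    rewrite (bigD1 s) //= big1 ?addr0 => [|t /negPf ts]; rewrite coordsK // /f0.
      by rewrite !eqxx.
    by rewrite ts mul0r.
  exists (\sum_(l < m) c l *: w l); rewrite raddf_sum; apply: eq_bigr => l _.
  by rewrite /= linearZ /= wE.
exists (betti 0%N), (fun l => v 0 l), (fun l => umon k (enum_val l).1); split=> [l|].
  by apply/GL; exists (enum_val l).1 => //; have := enum_valP l; rewrite inE => /and3P[].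
rewrite /eps /aug; under eq_bigr => s _ do rewrite mulr_suml big_mkcond.
rewrite exchange_big; apply: eq_bigr => l _ /=.
have /and3P[_ _] : cell 0%N (enum_val l).1 (enum_val l).2.
  by have := enum_valP l; rewrite inE.
case: (enum_val l) => t B /= /eqP/cards0_eq->; rewrite (bigD1 t) //= eqxx.
by rewrite big1 ?addr0 // => s st; rewrite xpair_eqE eq_sym (negPf st).
Qed.

(** The cells of dimension [q] index a basis of the [q]-th module. Every
    coefficient of the boundary is a signed variable, so each step raises the
    degree by exactly one and the resolution is linear. *)
Theorem cubical_linear_resolution (G : S -> Prop) :
  (forall g, G g <-> exists2 s, s \in L & g = umon k s) ->
  has_linear_resolution (ideal_gen G).
Proof.
move=> GL; exists (r.-1 * n)%N; split.
  exists G; split=> // g /GL[s _ ->]; exact: umon_homog.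
have chain0 q (v : 'rV[S]_(betti q)) : (forall s B, chain v s B = 0) <-> v = 0.
  split=> [v0|-> s B]; last by rewrite /chain big1 // => l _; rewrite mxE.
  by rewrite -(chainK v); apply/rowP=> l; rewrite !mxE v0.
have bd_phi q (w : 'rV[S]_(betti q.+1)) s B : chain (phi w) s B = bd (chain w) s B.
  exact/coordsK/carried_bd/carried_chain.
have exactE q (v : 'rV[S]_(betti q)) : (forall s B, bd (chain v) s B = 0) ->
    (q = 0%N -> aug (chain v) = 0) -> exists w, phi w = v.
  move=> cyc top; have [g [gq gE]] := cubical_exact (@carried_chain q v) cyc top.
  exists (coords q.+1 g); rewrite -[RHS]chainK; apply: eq_coords => s B.
  by rewrite -gE; apply: eq_bd => t C; apply: coordsK.
exists betti, eps, phi; split.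
- exact: eps_degree.
- exact: phi_degree.
- by move=> f; apply: eps_image.
- move=> v; split=> [v0|[w <-]]; last first.
    rewrite -[RHS](aug_bd (chain w)); apply: eq_bigr => s _.
    by rewrite bd_phi.
  apply: exactE => [s B|_]; last exact: v0.
  apply: big1 => i iB.
  have no0 t : chain v t (i |: B) = 0.
    apply/eqP; apply: contraT => /carried_chain/and3P[_ _].
    by rewrite cards_eq0 => /eqP/setP/(_ i); rewrite setU11 inE.
  by rewrite !no0 subrr mulr0.
move=> q v; split=> [v0|[w <-]].
  by apply: exactE => // s B; rewrite -bd_phi v0; apply: (proj2 (chain0 _ _)).
apply/chain0 => s B; rewrite bd_phi -[RHS](bd_bd (chain w) s B).
by apply: eq_bd => t C; apply: bd_phi.
Qed.

End Resolution.

(** * Multichains of poset ideals *)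

Section LevelMaps.
Variables (P : finType) (n r : nat) (p : 'I_n -> P) (le : 'I_r.-1 -> rel P).
Local Notation V := {ffun 'I_n -> 'I_r}.

(** A multichain of poset ideals, encoded by the number [s i] of ideals of the
    chain that contain [p i]; as the ideals decrease, these are the first [s i]
    ones. *)
Definition level_maps : {set V} :=
  [set s : V | [forall a : 'I_r.-1, forall i, forall j,
     le a (p j) (p i) ==> (a < s i) ==> (a < s j)]].

Lemma level_mapsP (s : V) :
  reflect (forall (a : 'I_r.-1) i j, le a (p j) (p i) -> a < s i -> a < s j)
    (s \in level_maps).
Proof.
rewrite inE; apply: (iffP forallP) => [sL a i j|sL a].
  by have /forallP/(_ i)/forallP/(_ j)/implyP sL' := sL a => /sL'/implyP.
apply/forallP=> i; apply/forallP=> j; apply/implyP=> ji; apply/implyP.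
exact: sL ji.
Qed.

(** Lowering both coordinates gives the componentwise minimum of the two single
    lowerings, and minima correspond to intersections of ideals. *)
Lemma level_maps_square (s : V) i j : i != j ->
  i \in drops level_maps s -> j \in drops level_maps s ->
  dn j (dn i s) \in level_maps.
Proof.
move=> ij; rewrite !in_drops => /andP[si /level_mapsP iL] /andP[sj /level_mapsP jL].
have sji : dn i s j = s j by rewrite dn_neq // eq_sym.
have dn2i : dn j (dn i s) i = dn i s i by rewrite dn_neq.
have dn2j : dn j (dn i s) j = dn j s j by rewrite !ffunE eqxx eq_sym (negPf ij).
have dn2 l : (dn j (dn i s) l = minn (dn i s l) (dn j s l) :> nat).
  have [->|li] := eqVneq l i.
    by rewrite dn2i (dn_neq _ ij) dn_diag // (minn_idPl (leq_pred _)).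
  have [->|lj] := eqVneq l j.
    by rewrite dn2j sji dn_diag // (minn_idPr (leq_pred _)).
  by rewrite !dn_neq // minnn.
apply/level_mapsP=> a l l' ll'; rewrite !dn2 !leq_min => /andP[/(iL _ _ _ ll')-> al].
exact: jL ll' al.
Qed.

Hypothesis le_po : forall a, partial_order (le a).
Hypothesis p_inj : injective p.

(** Minimizing the number of elements above yields a maximal element. *)
Lemma maximal_in (a : 'I_r.-1) (W : {set 'I_n}) i0 : i0 \in W ->
  exists2 i, i \in W & forall j, j \in W -> le a (p i) (p j) -> j = i.
Proof.
move=> i0W; have [refl anti trans] := le_po a.
pose above i := [set j in W | le a (p i) (p j)].
case: (arg_minnP (fun i => #|above i|) i0W) => i iW0 imin.
have iW : i \in W := iW0; exists i => // j jW ij.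
apply/eqP; apply: contraTT (imin j jW) => ji; rewrite -ltnNge proper_card //.
apply/properP; split.
  by apply/subsetP=> l; rewrite !inE => /andP[-> /(trans _ _ _ ij)].
exists i; first by rewrite inE iW refl.
rewrite inE iW /=; apply: contra ji => ji; apply/eqP/p_inj/anti.
by rewrite ji.
Qed.

(** Let [a] be the last place where the ideal given by [s] is not contained in
    the one given by [t], and pick [i] maximal for [le a] in the difference of
    the two. Since [t] is given by an ideal at [a], this [i] is maximal in the
    whole ideal of [s] at [a]; by the choice of [a], it does not belong to the
    next ideal of [s]. So [i] may be removed from the ideal at [a] alone.
    Antisymmetry is essential here: for preorders the ideal need not have a
    linear resolution. *)
Lemma level_maps_exchange (s t : V) j :
  s \in level_maps -> t \in level_maps -> t j < s j ->
  exists2 i, i \in drops level_maps s & t i < s i.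
Proof.
move=> /level_mapsP sL /level_mapsP tL tj.
(* The largest value [s i] with [t i < s i] gives the place [a = s i - 1]. *)
case: (@arg_maxnP _ j (fun i => t i < s i) (fun i => s i)) => // i1 ti1 smax.
have s_gt0 : 0 < s i1 by apply: leq_ltn_trans ti1.
have ar : (s i1).-1 < r.-1 by rewrite -ltnS !prednK // (leq_ltn_trans _ (ltn_ord (s i1))).
pose a : 'I_r.-1 := Ordinal ar.
(* The elements of the ideal of [s] at [a] outside the ideal of [t] at [a]. *)
pose W := [set i | t i <= a < s i].
have i1W : i1 \in W by rewrite inE /= -ltnS prednK // ti1 leqnn.
have [i iW imax] := maximal_in a i1W.
have /andP[ta as_] : t i <= a < s i by rewrite inE in iW.
have ti : t i < s i by apply: leq_ltn_trans as_.
have siE : s i = a.+1 :> nat.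
  by apply/eqP; rewrite eqn_leq as_ andbT /= prednK //; apply: smax.
exists i => //; rewrite in_drops siE /=; apply/level_mapsP=> b l l' l'l.
have dnl m : dn i s m <= s m.
  have [->|mi] := eqVneq m i; last by rewrite dn_neq.
  by rewrite dn_diag ?siE.
move=> bl; have bs : b < s l' by apply: sL l'l _; apply: leq_trans bl (dnl l).
have [El|l'i] := eqVneq l' i; last by rewrite dn_neq.
rewrite El dn_diag ?siE //=; rewrite El siE ltnS leq_eqVlt in bs.
case/orP: bs => // /eqP ba; have {ba} Eb : b = a by apply: val_inj.
move: bl l'l; rewrite Eb El => al il.
have al' : a < s l by apply: leq_trans al (dnl l).
have lW : l \in W.
  by rewrite inE al' andbT leqNgt; apply: contraTN ta => /(tL _ _ _ il); rewrite -ltnNge.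
by have li := imax l lW il; move: al; rewrite li dn_diag siE //= ltnn.
Qed.

End LevelMaps.

(** At place [a], column [i] contributes the variable of level [a] or [a + 1]
    according to whether [a < s i]; so the [r - 1] places enumerate, in order,
    all the levels other than [s i]. *)
Lemma u_multichainE (k : fieldType) (P : finType) n r (p : 'I_n -> P)
    (I : {ffun 'I_r.-1 -> {set P}}) (s : {ffun 'I_n -> 'I_r}) :
  (forall a i, (p i \in I a) = (a < s i)) -> u_multichain k p I = umon k s.
Proof.
move=> Is; apply: eq_bigr => a _; rewrite /u_poset_ideal.
rewrite [RHS](bigID (fun i => p i \in I a)) /=.
congr (_ * _)%R; apply: eq_bigr => i; rewrite Is => as_; congr ('X_(mxvec_index _ _))%R;
  apply: val_inj => /=; rewrite /bump.
  by rewrite leqNgt as_.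
by rewrite leqNgt as_.
Qed.

Theorem proposition3p4 (k : fieldType) (P : finType) (n r : nat)
  (p : 'I_n -> P) (hp : bijective p) (hr : 2 <= r)
  (le : 'I_r.-1 -> rel P) (hle : forall a, partial_order (le a)) :
  has_linear_resolution (hibi_ideal k p le).
Proof.
have r_gt0 : 0 < r by apply: ltnW.
have [q pK qK] := hp.
apply: (@cubical_linear_resolution k n r (level_maps p le)) => [||g].
- exact: level_maps_square.
- exact/level_maps_exchange/(can_inj pK).
split=> [[I Imul ->]|[s /level_mapsP sL ->]].
  move: Imul; rewrite inE => /andP[/forallP Iideal /forallP Ichain].
  have le_top i : \max_(a < r.-1 | p i \in I a) a.+1 < r.
    rewrite -[r in _ < r](prednK r_gt0) ltnS; apply/bigmax_leqP => a _.
    exact: ltn_ord.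
  pose s : {ffun 'I_n -> 'I_r} := [ffun i => Ordinal (le_top i)].
  have Is a i : (p i \in I a) = (a < s i).
    rewrite ffunE /=; apply/idP/idP => [ia|]; first exact: leq_bigmax_cond.
    apply: contraTT => ia; rewrite -leqNgt; apply/bigmax_leqP => b ib.
    rewrite ltnNge; apply: contra ia => ab.
    by have /forallP/(_ b)/implyP/(_ ab)/subsetP := Ichain a; apply.
  exists s; last exact: u_multichainE.
  apply/level_mapsP=> a i j ji; rewrite -!Is => ia.
  have := Iideal a; rewrite inE => /forall_inP/(_ _ ia)/forallP/(_ (p j)).
  by rewrite ji.
pose I := [ffun a : 'I_r.-1 => p @: [set i | a < s i]].
have Is a i : (p i \in I a) = (a < s i).
  by rewrite ffunE mem_imset ?inE //; apply: can_inj pK.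
exists I; last by rewrite (u_multichainE k Is).
rewrite inE; apply/andP; split; apply/forallP=> a.
  rewrite inE; apply/forall_inP => x; rewrite -(qK x) Is => ax.
  apply/forallP=> y; rewrite -(qK y) Is; apply/implyP=> yx.
  exact: sL yx ax.
apply/forallP=> b; apply/implyP=> ab; apply/subsetP=> x.
by rewrite -(qK x) !Is; apply: leq_ltn_trans.
Qed.
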